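(* Let $d\geq 1$. For each $d$-tuple $\sigma=(\sigma_0,\ldots,\sigma_{d-1})\in\{+,-\}^d$, there exists exactly one open (connected) component of the set $\Pi_d^*\subset\mathbb{R}^d$ whose polynomials $Q_d=x^d+\sum_{j=0}^{d-1}a_jx^j$ have exactly $pos$ positive simple roots and $neg$ negative simple roots and satisfy $\mathrm{sign}(a_j)=\sigma_j$ for $j=0,\ldots,d-1$. This component is contractible.
   Context: A monic real polynomial $Q_d=x^d+\sum_{j=0}^{d-1}a_jx^j$ is identified with the point $(a_0,\ldots,a_{d-1})\in\mathbb{R}^d$. The set $\Pi_d^*\subset\mathbb{R}^d$ is the (open) set of monic degree $d$ real polynomials $Q_d$ having $d$ distinct real roots and with all coefficients $a_0,\ldots,a_{d-1}$ non-zero. The numbers $pos$ and $neg$ are determined by $\sigma$ via Descartes' rule of signs: $pos$ is the number of sign changes and $neg=d-pos$ is the number of sign preservations between consecutive entries in the sequence of signs $(+,\sigma_{d-1},\ldots,\sigma_1,\sigma_0)$. *)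

(* Defs.v *)
From HB Require Import structures.
From mathcomp Require Export all_boot all_order all_algebra.
From mathcomp Require Export all_classical all_reals all_analysis.
Export Order.TTheory GRing.Theory Num.Theory.
Export numFieldNormedType.Exports.

Set Implicit Arguments.
Unset Strict Implicit.
Unset Printing Implicit Defensive.

Local Open Scope classical_set_scope.
Local Open Scope card_scope.
Local Open Scope ring_scope.

Definition monic_poly_of (R : realType) (d : nat) (a : 'rV[R]_d) : {poly R} :=
  'X^d + \sum_(j < d) a 0 j *: 'X^j.

Definition Pi_star (R : realType) (d : nat) : set 'rV[R]_d :=
  [set a | [set x | root (monic_poly_of a) x] #= `I_d /\
           forall j, a 0 j != 0].
Arguments Pi_star : clear implicits.

(* A sign is a boolean, [true] standing for "-", so that its value is
   [(-1) ^+ b]; the leading sign "+" of a monic polynomial is [false].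
   A tuple of signs [s] lists the sign of the coefficient of X^j at index j,
   hence the reversal below. *)
Definition sign_changes (d : nat) (s : d.-tuple bool) : nat :=
  count id (pairmap (fun b c => b != c) false (rev s)).

Definition sign_preservations (d : nat) (s : d.-tuple bool) : nat :=
  count id (pairmap (fun b c => b == c) false (rev s)).

Lemma sign_preservationsE (d : nat) (s : d.-tuple bool) :
  sign_preservations s = (d - sign_changes s)%N.
Proof.
rewrite /sign_preservations /sign_changes.
suff : forall b, count id (pairmap (fun b c => b == c) b (rev s)) =
    (size (rev s) - count id (pairmap (fun b c => b != c) b (rev s)))%N.
  by move=> ->; rewrite size_rev size_tuple.
elim: (rev s) => [|c t IH] b //=.
have le_ch : (count id (pairmap (fun b c => b != c) c t) <= size t)%N.
  by rewrite -(size_pairmap (fun b c => b != c) c t) count_size.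
by rewrite IH; case: eqP => _ /=; rewrite ?add1n ?add0n ?subSS ?subSn.
Qed.

Definition positive_simple_roots (R : realType) (p : {poly R}) : set R :=
  [set x | 0 < x /\ mup x p = 1%N].

Definition negative_simple_roots (R : realType) (p : {poly R}) : set R :=
  [set x | x < 0 /\ mup x p = 1%N].

Definition realizes (R : realType) (d : nat) (s : d.-tuple bool)
    (a : 'rV[R]_d) : Prop :=
  [/\ positive_simple_roots (monic_poly_of a) #= `I_(sign_changes s),
      negative_simple_roots (monic_poly_of a) #= `I_(sign_preservations s) &
      forall j, Num.sg (a 0 j) = (-1) ^+ tnth s j].

(* [A], with the topology induced by [T], is contractible: its identity map is
   homotopic, inside [A], to a constant map. In particular [A] is nonempty. *)
Definition contractible (R : realType) (T : topologicalType) (A : set T) :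
    Prop :=
  exists2 x0 : T, A x0 & exists H : T * R -> T,
    [/\ {within (A `*` `[0, 1]%classic : set (T * R)), continuous H},
        forall x (t : R), A x -> t \in `[0, 1] -> A (H (x, t)),
        forall x, A x -> H (x, 0) = x &
        forall x, A x -> H (x, 1) = x0].
Arguments contractible R {T} A.

(* Main.v *)
Require Import Defs.
From mathcomp Require Import finmap ring lra.

Set Implicit Arguments.
Unset Strict Implicit.
Unset Printing Implicit Defensive.

Local Open Scope classical_set_scope.
Local Open Scope card_scope.
Local Open Scope ring_scope.

(** Let [sign_class s] be the set of points of [Pi_star R d] whose coefficients
have the signs [s]. No coefficient vanishes on [Pi_star R d], so a connected
subset of it stays in a single sign class. The theorem therefore reduces to
three facts: [sign_class s] is open, it is contractible (hence connected, hence
a whole component), and all its points realize [s].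

The contraction rests on the Euler operator. For [e >= 0], the polynomial
[p + e X p'] has coefficients [(1 + e j) a_j], so the signs are kept. It also
has as many distinct real roots as [p], and as many positive ones: at the roots
of [X p] it agrees, up to positive factors, with the derivative of [X p], whose
sign alternates there ([full_roots_step]). As the sequence [1 + e j] is strictly
log-concave in [j], iterating such operators makes the coefficients as
log-concave as desired: every point of the sign class is driven to the region
[9 |a_j a_(j+2)| <= a_(j+1) ^ 2] of lacunary polynomials ([lacunary_flow]).

On that region the roots can be located directly. Around well chosen radii a
single term dominates, so a polynomial with lacunary coefficients, whatever
their signs, has [d] distinct real roots, and its positive roots correspond to
the sign changes ([lacunary_full_roots]). In the coordinates [ln |a_j|] the
lacunary region is defined by affine inequalities, hence convex.

So a polynomial is first pushed along the Euler flow until it is lacunary,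
which takes a time bounded by a continuous function of the coefficients
([escape_time]), and is then moved in a straight line, in logarithmic
coordinates, to a fixed lacunary polynomial. Since the flow keeps the number of
positive roots, it also gives the equality case of the rule of Descartes for
real-rooted polynomials ([full_roots_count_pos]), that is, the fact that every
point of [sign_class s] realizes [s]. *)

(** * Real-rooted polynomials and the Euler operator *)

Section RealRooted.
Variable R : realType.
Implicit Types (p q : {poly R}) (rs : seq R).

(** All complex roots of [p] are real and simple, and [rs] lists them: the size
condition makes [rs] exhaustive. *)
Definition full_roots p rs :=
  [&& uniq rs, size p == (size rs).+1 & all (root p) rs].

Lemma full_roots_neq0 p rs : full_roots p rs -> p != 0.
Proof. by case/and3P=> _ /eqP sp _; rewrite -size_poly_eq0 sp. Qed.

Lemma mem_full_roots p rs x : full_roots p rs -> (x \in rs) = root p x.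
Proof.
move=> frs; have p0 := full_roots_neq0 frs.
case/and3P: frs => urs /eqP sp ars; apply/idP/idP => [/(allP ars)//|rx].
apply: contraT => xrs.
have := @max_poly_roots _ p (x :: rs) p0; rewrite /= rx ars xrs urs sp.
by move=> /(_ erefl erefl); rewrite ltnn.
Qed.

Lemma full_roots_perm p rs1 rs2 :
  full_roots p rs1 -> full_roots p rs2 -> perm_eq rs1 rs2.
Proof.
move=> f1 f2; apply: uniq_perm; [by case/and3P: f1|by case/and3P: f2|].
by move=> x; rewrite (mem_full_roots _ f1) (mem_full_roots _ f2).
Qed.

Lemma full_rootsE p rs :
  full_roots p rs -> p = lead_coef p *: \prod_(r <- rs) ('X - r%:P).
Proof.
by case/and3P=> urs /eqP sp ars; apply: all_roots_prod_XsubC; rewrite ?uniq_rootsE.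
Qed.

Lemma full_rootsZ c p rs : c != 0 -> full_roots (c *: p) rs = full_roots p rs.
Proof.
move=> c0; rewrite /full_roots size_scale//; congr [&& _, _ & _].
by apply: eq_all => x; rewrite rootZ.
Qed.

Lemma poly_ivt_strict p a b : a < b -> p.[a] * p.[b] < 0 ->
  exists2 z, a < z < b & root p z.
Proof.
move=> ab; wlog pa : p / p.[a] < 0 => [hw pab|].
  have [pa|pa|pa] := ltgtP p.[a] 0; first exact: hw.
  - have [||z zab] := hw (- p); rewrite ?hornerN ?oppr_lt0 ?mulrNN//.
    by rewrite rootN; exists z.
  - by rewrite pa mul0r ltxx in pab.
rewrite nmulr_rlt0// => pb.
have [|z /andP[az zb] rz] := @poly_ivt _ p a b (ltW ab); first by rewrite !ltW.
exists z => //; rewrite !lt_neqAle az zb !andbT; apply/andP; split.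
  by apply: contraTneq rz => <-; rewrite rootE lt_eqF.
by apply: contraTneq rz => ->; rewrite rootE gt_eqF.
Qed.

(** With [G = (X - y) (X - y') Q], the derivative takes the values
[(y - y') Q(y)] and [(y' - y) Q(y')] at the two roots, and [Q] has the same
sign at both because it has no root between them. *)
Lemma deriv_consecutive_roots (l : seq R) (y y' : R) (r : seq R) :
  sorted <%R (l ++ [:: y, y' & r]) ->
  (\prod_(z <- l ++ [:: y, y' & r]) ('X - z%:P))^`().[y] *
  (\prod_(z <- l ++ [:: y, y' & r]) ('X - z%:P))^`().[y'] < 0 :> R.
Proof.
rewrite (sorted_pairwise lt_trans) pairwise_cat /= => /and3P[+ _].
rewrite allrel_consr allrel_consr => /and3P[ly ly' _] /and3P[/andP[yy' yr] y'r _].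
rewrite big_cat !big_cons /=.
set Q := (\prod_(z <- l) ('X - z%:P)) * (\prod_(z <- r) ('X - z%:P)).
have -> : forall A B C D : {poly R}, A * (B * (C * D)) = B * (C * (A * D)).
  by move=> A B C D; rewrite mulrCA; congr (_ * _); rewrite mulrCA.
rewrite -/Q.
have Q0 : 0 < Q.[y] * Q.[y'].
  rewrite !hornerM !horner_prod mulrACA -!big_split /= mulr_gt0//.
  - rewrite big_seq; apply: prodr_gt0 => z zl; rewrite !hornerE.
    by rewrite mulr_gt0// subr_gt0; [exact: (allP ly)|exact: (allP ly')].
  - rewrite big_seq; apply: prodr_gt0 => z zr; rewrite !hornerE.
    by rewrite nmulr_rgt0 subr_lt0; [exact: (allP y'r)|exact: (allP yr)].
clearbody Q; rewrite !derivM !derivXsubC !mul1r !hornerE /= !subrr !mul0r !addr0 !add0r.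
have y2 : 0 < (y' - y) ^+ 2 by rewrite exprn_gt0// subr_gt0.
rewrite -oppr_gt0 (_ : - _ = (y' - y) ^+ 2 * (Q.[y] * Q.[y'])); last by ring.
exact: mulr_gt0.
Qed.

Lemma roots_between g (y : nat -> R) n :
  (forall i, (i < n)%N -> y i < y i.+1) ->
  (forall i, (i < n)%N -> g.[y i] * g.[y i.+1] < 0) ->
  exists z : nat -> R, forall i, (i < n)%N -> y i < z i < y i.+1 /\ root g (z i).
Proof.
move=> ylt galt.
suff /choice[z zP] : forall i, exists z, (i < n)%N -> y i < z < y i.+1 /\ root g z.
  by exists z.
move=> i; case: (ltnP i n) => [ilt|_]; last by exists 0.
by have [z ? ?] := poly_ivt_strict (ylt _ ilt) (galt _ ilt); exists z.
Qed.

Lemma coef_euler_step p (e : R) i : (p + e *: ('X * p^`()))`_i = (1 + e * i%:R) * p`_i.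
Proof.
rewrite coefD coefZ coefXM coef_deriv; case: i => [|i] /=; first by ring.
by rewrite -mulr_natr; ring.
Qed.

Lemma size_euler_step p (e : R) : 0 <= e -> size (p + e *: ('X * p^`())) = size p.
Proof.
move=> e0; have h i : (p + e *: ('X * p^`()))`_i == 0 = (p`_i == 0).
  by rewrite coef_euler_step mulf_eq0 gt_eqF// ltr_wpDr// mulr_ge0.
apply/eqP; rewrite eqn_leq; apply/andP; split; apply/leq_sizeP => j jp; apply/eqP.
  by rewrite h nth_default.
by rewrite -h nth_default.
Qed.

(** At a nonzero root [y] of [p], the polynomial [p + e X p'] takes the value
[e y p'(y)], which is [e] times the derivative of [X p] at [y]; at [0] both take
the value [p(0)]. The sign of that derivative alternates along the roots of
[X p], so the new roots interlace with those of [X p]. As [0] is among the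
latter, exactly the intervals starting at or after [0] give positive roots. *)
Lemma full_roots_step p rs (e : R) : 0 <= e -> ~~ root p 0 -> full_roots p rs ->
  exists2 rs', full_roots (p + e *: ('X * p^`())) rs' &
    count (> 0) rs' = count (> 0) rs.
Proof.
rewrite le_eqVlt => /predU1P[<- _ frs|e0 p00 frs].
  by exists rs => //; rewrite scale0r addr0.
have /and3P[urs /eqP sp ars] := frs.
have rs0 : 0 \notin rs by rewrite (mem_full_roots _ frs).
(* The increasing list of the roots of [X p]. *)
pose ys := sort <=%R (0 :: rs).
have sys : size ys = (size rs).+1 by rewrite size_sort.
have ssys : sorted <%R ys.
  by rewrite lt_sorted_uniq_le sort_uniq /= rs0 urs sort_sorted//; exact: le_total.
pose y := nth 0 ys.
have ylt i : (i < size rs)%N -> y i < y i.+1.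
  by move=> il; apply: (elimT (sortedP 0) ssys); rewrite sys ltnS.
have y_mono i j : (j < (size rs).+1)%N -> (i < j)%N -> y i < y j.
  move=> jl ij; rewrite /y lt_sorted_ltn_nth// inE sys//.
  exact: ltn_trans jl.
set g := p + _.
pose G := \prod_(z <- ys) ('X - z%:P).
have XpG : 'X * p = lead_coef p *: G.
  rewrite {1}(full_rootsE frs) -scalerAr; congr (_ *: _).
  rewrite /G [RHS](perm_big (0 :: rs)) ?perm_sort//.
  by rewrite big_cons polyC0 subr0.
have gG (z : R) : z \in ys -> exists2 k : R, 0 < k & g.[z] = k * lead_coef p * G^`().[z].
  have dG : lead_coef p *: G^`() = p + 'X * p^`().
    rewrite -derivZ -XpG derivM derivX.
    by rewrite mul1r.
  have dGz : lead_coef p * G^`().[z] = p.[z] + z * p^`().[z].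
    by rewrite -hornerZ dG !hornerE.
  rewrite mem_sort inE (mem_full_roots _ frs) => /predU1P[z0|/rootP pz0].
    by exists 1 => //; rewrite mul1r dGz z0 /g !hornerE /= mulr0 mul0r addr0.
  by exists e => //; rewrite -mulrA dGz /g !hornerE pz0 !add0r /= mulrA.
have galt i : (i < size rs)%N -> g.[y i] * g.[y i.+1] < 0.
  move=> il.
  have yin j : (j < (size rs).+1)%N -> y j \in ys by move=> ?; rewrite mem_nth// sys.
  have [k k0 ->] := gG (y i) (yin _ (ltnW il)).
  have [k' k'0 ->] := gG (y i.+1) (yin i.+1 il).
  have : G^`().[y i] * G^`().[y i.+1] < 0.
    have ysE : ys = take i ys ++ [:: y i, y i.+1 & drop i.+2 ys].
      by rewrite -!drop_nth ?sys ?cat_take_drop// ltnW.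
    rewrite /G ysE; apply: deriv_consecutive_roots; by rewrite -ysE.
  have lp : 0 < lead_coef p ^+ 2.
    by rewrite exprn_even_gt0//= lead_coef_eq0 (full_roots_neq0 frs).
  move=> GG; rewrite (_ : _ * _ * _ * _ = (k * k' * lead_coef p ^+ 2) *
    (G^`().[y i] * G^`().[y i.+1])); last by ring.
  by rewrite pmulr_rlt0//; apply: mulr_gt0 lp; exact: mulr_gt0.
have [z zP] := roots_between ylt galt.
have zlt i j : (j < size rs)%N -> (i < j)%N -> z i < z j.
  move=> jl ij; have il := ltn_trans ij jl.
  have [/andP[_ h1] _] := zP _ il; have [/andP[h2 _] _] := zP _ jl.
  apply: lt_trans h1 (le_lt_trans _ h2).
  move: ij; rewrite leq_eqVlt => /predU1P[<-//|?]; apply/ltW/y_mono => //; exact: ltnW.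
exists (mkseq z (size rs)).
  apply/and3P; split.
  - apply/mkseq_uniqP => i j; rewrite !inE => il jl zz.
    by case: (ltngtP i j) => // [/(zlt _ _ jl)|/(zlt _ _ il)]; rewrite zz ltxx.
  - by rewrite size_mkseq size_euler_step ?sp// ltW.
  - apply/allP => _ /mapP[i + ->]; rewrite mem_iota /= add0n => il.
    by have [] := zP _ il.
have ysE : ys = y 0%N :: mkseq (y \o succn) (size rs).
  apply: (@eq_from_nth _ 0); rewrite /= ?size_mkseq// => -[|i]//=.
  by rewrite sys ltnS => il; rewrite nth_mkseq.
have y0 : y 0%N <= 0.
  have : 0 \in ys by rewrite mem_sort mem_head.
  move=> /(nthP 0)[[|i]]; rewrite sys; first by rewrite -/y => _ ->.
  by move=> il <-; exact/ltW/y_mono.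
have -> : count (> 0) rs = count (> 0) (mkseq (y \o succn) (size rs)).
  transitivity (count (> 0) ys).
    by rewrite /ys (permP (permEl (perm_sort _ _))) /= ltxx.
  by rewrite ysE /= ltNge y0.
rewrite !count_map; apply: eq_in_count => i; rewrite mem_iota /= add0n => il.
have [/andP[yz zy] _] := zP _ il.
apply/idP/idP => [z0|yi0]; first exact: lt_trans zy.
apply: le_lt_trans yz.
have : 0 \in ys by rewrite mem_sort mem_head.
move=> /(nthP 0)[j]; rewrite sys -/(y j) => jl j0.
rewrite -j0; case: (leqP j i); rewrite leq_eqVlt => /predU1P[ij|ij].
- by rewrite ij.
- exact/ltW/y_mono/ij/ltnW.
- by move: yi0; rewrite /= ij j0 ltxx.
- by have := lt_trans yi0 (y_mono _ _ jl ij); rewrite j0 ltxx.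
Qed.

End RealRooted.

(** * Polynomials with lacunary coefficients *)

Section Lacunary.
Variable R : realType.
Implicit Types (t c : nat -> R) (x : R).

(** The two geometric bounds below leave each side with less than half of the
dominant term. *)
Lemma geometric_sum_below t j : 0 < t 0%N ->
  (forall i, (i < j)%N -> 3 * t i <= t i.+1) -> 2 * \sum_(0 <= i < j) t i < t j.
Proof.
move=> t0; elim: j => [|j IH] ht; first by rewrite big_geq// mulr0.
have := IH (fun i il => ht i (ltnW il)); have := ht j (ltnSn j).
by rewrite big_nat_recr//=; lra.
Qed.

Lemma geometric_sum_above t j n : (j <= n)%N -> 0 < t n ->
  (forall i, (j <= i < n)%N -> 3 * t i.+1 <= t i) ->
  2 * \sum_(j.+1 <= i < n.+1) t i < t j.
Proof.
move=> /subnK <-; move: (n - j)%N => k; elim: k j => [|k IH] j tn ht.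
  by rewrite big_geq// mulr0.
rewrite addSnnS in tn ht *.
have jk : (j <= k + j)%N by rewrite leq_addl.
have ht1 i : (j < i < k + j.+1)%N -> 3 * t i.+1 <= t i.
  by move=> /andP[ji ik]; apply: ht; rewrite ltnW.
have hj : 3 * t j.+1 <= t j by apply: ht; rewrite leqnn addnS ltnS jk.
have := IH j.+1 tn ht1.
rewrite [X in _ -> 2 * X < _]big_ltn; last by rewrite ltnS leq_addl.
lra.
Qed.

Lemma dominant_term_sign (d : nat) c x j : (j <= d)%N ->
  (forall i, (i <= d)%N -> 0 < `|c i * x ^+ i|) ->
  (forall i, (i < j)%N -> 3 * `|c i * x ^+ i| <= `|c i.+1 * x ^+ i.+1|) ->
  (forall i, (j <= i < d)%N -> 3 * `|c i.+1 * x ^+ i.+1| <= `|c i * x ^+ i|) ->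
  0 < (\poly_(i < d.+1) c i).[x] * (c j * x ^+ j).
Proof.
move=> jd tpos lo hi; rewrite horner_poly -(big_mkord xpredT (fun i => c i * x ^+ i)).
rewrite (big_cat_nat (leq0n j) (leqW jd)) /= (big_ltn (n:=d.+1))//.
set A := \sum_(0 <= i < j) _; set B := \sum_(j.+1 <= i < d.+1) _.
have hA : 2 * `|A| < `|c j * x ^+ j|.
  apply: le_lt_trans (geometric_sum_below (tpos 0%N _) lo) => //.
  by rewrite ler_pM2l// ler_norm_sum.
have hB : 2 * `|B| < `|c j * x ^+ j|.
  apply: le_lt_trans (geometric_sum_above jd (tpos d _) hi) => //.
  by rewrite ler_pM2l// ler_norm_sum.
set u := c j * x ^+ j in hA hB *.
have : - `|A| <= A <= `|A| by rewrite -ler_norml.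
have : - `|B| <= B <= `|B| by rewrite -ler_norml.
case: (lerP 0 u) hA hB => u0; [rewrite (ger0_norm u0)|rewrite (ltr0_norm u0)];
  by move=> hA hB /andP[B1 B2] /andP[A1 A2]; nra.
Qed.

(** The ratios [q j = |c j| / |c j.+1|] grow at least by a factor 9, and at a point
of modulus [3 * q j] the term of degree [j.+1] is at least 3 times its two
neighbours, hence dominates the sum. So the signs of the polynomial at the
points [e * r j], for [e] equal to 1 or -1 and radii [r 0 = 0] and
[r j.+1 = 3 * q j], are those of [c j * e ^+ j]. Between the radii [r j] and
[r j.+1] the polynomial thus changes sign on the positive side if [c j] and
[c j.+1] have opposite signs, and on the negative side otherwise. *)
Lemma lacunary_full_roots (d : nat) c :
  (forall j, (j <= d)%N -> c j != 0) ->
  (forall j, (j.+1 < d)%N -> 9 * `|c j * c j.+2| <= c j.+1 ^+ 2) ->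
  exists2 rs, full_roots (\poly_(j < d.+1) c j) rs &
    count (> 0) rs = count (fun j => c j * c j.+1 < 0) (iota 0 d).
Proof.
move=> c0 lac; set p := \poly_(j < d.+1) c j.
pose q i := `|c i| / `|c i.+1|.
have q0 i : (i < d)%N -> 0 < q i.
  by move=> il; rewrite divr_gt0// normr_gt0 c0// ltnW.
have q9 i : (i.+1 < d)%N -> 9 * q i <= q i.+1.
  move=> il; rewrite /q ler_pdivlMr ?normr_gt0 ?c0//.
  rewrite -(ler_pM2r (_ : 0 < `|c i.+1|)) ?normr_gt0 ?c0 1?ltnW//.
  rewrite (_ : _ * _ * _ =
    9 * (`|c i| * `|c i.+2|) * (`|c i.+1| / `|c i.+1|)); last by ring.
  rewrite divff ?normr_eq0 ?c0 1?ltnW// mulr1 -normrM -expr2 real_normK ?num_real//.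
  exact: lac.
have qlt i j : (j < d)%N -> (i < j)%N -> 9 * q i <= q j.
  elim: j => // j IH jd; rewrite ltnS leq_eqVlt => /predU1P[->|ij]; first exact: q9.
  apply: le_trans (q9 _ jd); have := IH (ltnW jd) ij; have := q0 j (ltnW jd); lra.
have qle i j : (j < d)%N -> (i <= j)%N -> q i <= q j.
  move=> jd; rewrite leq_eqVlt => /predU1P[->//|ij].
  have := qlt _ _ jd ij; have := q0 i (ltn_trans ij jd); lra.
pose r j := if j is k.+1 then 3 * q k else 0.
have rlt j : (j < d)%N -> r j < r j.+1.
  case: j => [|j] jd /=; first by rewrite mulr_gt0// q0.
  by have := qlt j j.+1 jd (ltnSn _); have := q0 j (ltnW jd); lra.
have rle i j : (j <= d)%N -> (i <= j)%N -> r i <= r j.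
  elim: j => [|j IH] jd; first by rewrite leqn0 => /eqP->.
  rewrite leq_eqVlt => /predU1P[->//|ij].
  exact: le_trans (IH (ltnW jd) ij) (ltW (rlt _ jd)).
have psign e j : (j <= d)%N -> `|e| = 1 -> 0 < p.[e * r j] * (c j * e ^+ j).
  case: j => [|j] jd e1.
    by rewrite /= mulr0 expr0 mulr1 horner_coef0 coef_poly /= -expr2 exprn_even_gt0//= c0.
  have e0 : e != 0 by rewrite -normr_eq0 e1 oner_eq0.
  have x0 : 0 < 3 * q j by rewrite mulr_gt0// q0.
  have [x qx] : exists x, x = 3 * q j by exists (3 * q j).
  rewrite /= -qx in x0 *.
  have tE i : `|c i * (e * x) ^+ i| = `|c i| * x ^+ i.
    by rewrite normrM normrX normrM e1 mul1r (gtr0_norm x0).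
  have : 0 < p.[e * x] * (c j.+1 * (e * x) ^+ j.+1).
    apply: dominant_term_sign => // i; rewrite !tE.
    - by move=> id; rewrite mulr_gt0 ?normr_gt0 ?c0 ?exprn_gt0.
    - rewrite ltnS => ij; have id : (i < d)%N := leq_ltn_trans ij jd.
      rewrite exprS !mulrA ler_pM2r ?exprn_gt0//.
      have := qle _ _ jd ij; rewrite {1}/q ler_pdivrMr ?normr_gt0 ?c0//.
      by rewrite qx; lra.
    - move=> /andP[ji id].
      rewrite exprS !mulrA ler_pM2r ?exprn_gt0//.
      have := qlt _ _ id ji; rewrite {2}/q ler_pdivlMr ?normr_gt0 ?c0//.
      by rewrite qx; lra.
  by rewrite exprMn mulrA mulrA pmulr_lgt0 ?exprn_gt0// -mulrA.
(* The side on which the polynomial changes sign between [r j] and [r j.+1]. *)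
pose e j : R := if c j * c j.+1 < 0 then 1 else -1.
have e1 j : `|e j| = 1 by rewrite /e; case: ifP; rewrite ?normrN normr1.
have ee j : e j * e j = 1 by rewrite /e; case: ifP => _; rewrite ?mulrNN mulr1.
have palt j : (j < d)%N -> p.[e j * r j] * p.[e j * r j.+1] < 0.
  move=> jd; have h1 := psign (e j) j (ltnW jd) (e1 j).
  have h2 := psign (e j) j.+1 jd (e1 j).
  have := mulr_gt0 h1 h2; rewrite mulrACA.
  rewrite (_ : c j * _ * _ = (c j * c j.+1 * e j) * (e j ^+ j) ^+ 2); last first.
    by rewrite exprS; ring.
  rewrite -exprM mulnC exprM expr2 ee expr1n mulr1.
  suff : c j * c j.+1 * e j < 0 by move=> ?; rewrite nmulr_lgt0.
  rewrite /e; case: (ltP (c j * c j.+1) 0) => [|cc]; first by rewrite mulr1.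
  by rewrite mulrN1 oppr_lt0 lt_neqAle cc andbT eq_sym mulf_neq0// c0// ltnW.
suff /choice[z zP] : forall j, exists z, (j < d)%N -> r j < e j * z < r j.+1 /\ root p z.
  have zlt i j : (j < d)%N -> (i < j)%N -> e i * z i < e j * z j.
    move=> jd ij; have id := ltn_trans ij jd.
    have [/andP[_ h1] _] := zP _ id; have [/andP[h2 _] _] := zP _ jd.
    apply: lt_trans h1 (le_lt_trans _ h2).
    exact: rle (ltnW jd) ij.
  have zabs j : (j < d)%N -> `|z j| = e j * z j.
    move=> jd; have [/andP[rz _] _] := zP _ jd.
    rewrite -[LHS]mul1r -(e1 j) -normrM ger0_norm//.
    exact: le_trans (rle 0%N _ (ltnW jd) (leq0n _)) (ltW rz).
  exists (mkseq z d).
    apply/and3P; split.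
    - apply/mkseq_uniqP => i j; rewrite !inE => il jl zz.
      by case: (ltngtP i j) => // [/(zlt _ _ jl)|/(zlt _ _ il)];
        rewrite -!zabs// zz ltxx.
    - by rewrite size_mkseq size_poly_eq// c0.
    - apply/allP => _ /mapP[i + ->]; rewrite mem_iota /= add0n => il.
      by have [] := zP _ il.
  rewrite count_map; apply: eq_in_count => i; rewrite mem_iota /= add0n => il.
  have [/andP[+ _] _] := zP _ il.
  have := rle 0%N _ (ltnW il) (leq0n _); rewrite /e /=; case: ifP => _ ? ?; apply/idP; lra.
move=> j; case: (ltnP j d) => [jd|_]; last by exists 0.
have := palt _ jd; rewrite /e; case: ifP => _.
  rewrite !mul1r => /(poly_ivt_strict (rlt _ jd))[z zr rz]; exists z; rewrite mul1r.
  by [].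
rewrite !mulN1r mulrC => pz.
have := rlt _ jd; rewrite -ltrN2 => rr.
have [z /andP[z1 z2] rz] := poly_ivt_strict rr pz; exists z => _; split => //.
by rewrite mulN1r ltrNr ltrNl; apply/andP.
Qed.

End Lacunary.

(** * The Euler flow on coefficients *)

Section Flow.
Variables (R : realType) (d : nat).
Implicit Types (p : {poly R}) (e u : R).

(** Dividing by the value at [d] keeps polynomials monic. *)
Definition euler_factor e j : R := (1 + e * j%:R) / (1 + e * d%:R).

(** The coefficientwise multiplier after time [u]: one normalized Euler operator
with parameter [u - k] is switched on at each time [k]. The factors of later
index would have parameter 0, that is, be equal to 1, whence the continuity in
[u]; and every factor but the last has a parameter at least 1. *)
Definition flow u j : R :=
  \prod_(k < (Num.trunc u).+1) euler_factor (Num.max 0 (u - k%:R)) j.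

Lemma euler_factor_gt0 e j : 0 <= e -> 0 < euler_factor e j.
Proof. by move=> e0; rewrite divr_gt0// ltr_wpDr// mulr_ge0. Qed.

Lemma flow_gt0 u j : 0 < flow u j.
Proof. by apply: prodr_gt0 => k _; rewrite euler_factor_gt0// le_max lexx. Qed.

Lemma flow_top u : flow u d = 1.
Proof.
apply: big1 => k _; rewrite /euler_factor divff// gt_eqF// ltr_wpDr// mulr_ge0//.
by rewrite le_max lexx.
Qed.

Lemma flow0 j : flow 0 j = 1.
Proof.
rewrite /flow truncn0 big_ord1 /euler_factor subr0 maxxx !mul0r addr0.
by rewrite divr1.
Qed.

Lemma flow_prod u N j : u <= N%:R ->
  flow u j = \prod_(k < N) euler_factor (Num.max 0 (u - k%:R)) j.
Proof.
suff h : forall N M, u <= N%:R -> (N <= M)%N ->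
    \prod_(k < N) euler_factor (Num.max 0 (u - k%:R)) j =
    \prod_(k < M) euler_factor (Num.max 0 (u - k%:R)) j.
  move=> uN; rewrite /flow.
  case: (leqP (Num.trunc u).+1 N) => [|/ltnW] NM; first exact/h/NM/ltW/truncnS_gt.
  exact/esym/h.
move=> {}N M uN NM.
rewrite -!(big_mkord xpredT (fun k => euler_factor (Num.max 0 (u - k%:R)) j)).
rewrite (big_cat_nat (leq0n N) NM) /= [X in _ * X]big1_seq ?mulr1// => k /=.
rewrite mem_index_iota => /andP[Nk _].
rewrite (_ : Num.max _ _ = 0) ?/euler_factor ?mul0r ?addr0 ?divr1//.
by apply/max_idPl; rewrite subr_le0 (le_trans uN)// ler_nat.
Qed.

Lemma full_roots_euler_factor p rs e : 0 <= e -> p`_0 != 0 -> full_roots p rs ->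
  exists2 rs', full_roots (\poly_(j < size p) (euler_factor e j * p`_j)) rs' &
    count (> 0) rs' = count (> 0) rs.
Proof.
move=> e0 p0 frs.
have [|rs' frs' crs'] := full_roots_step e0 _ frs.
  by rewrite rootE horner_coef0.
exists rs' => //.
rewrite (_ : \poly_(_ < _) _ = (1 + e * d%:R)^-1 *: (p + e *: ('X * p^`()))).
  by rewrite full_rootsZ// invr_eq0 gt_eqF// ltr_wpDr// mulr_ge0.
apply/polyP => i; rewrite coef_poly coefZ coef_euler_step mulrA [_^-1 * _]mulrC.
by case: ltnP => // /(nth_default 0) ->; rewrite mulr0.
Qed.

Lemma full_roots_flow p rs u : p`_0 != 0 -> full_roots p rs ->
  exists2 rs', full_roots (\poly_(j < size p) (flow u j * p`_j)) rs' &
    count (> 0) rs' = count (> 0) rs.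
Proof.
rewrite /flow; elim: (_.+1) => [|N IH] p0 frs.
  exists rs => //; rewrite (_ : \poly_(_ < _) _ = p)//.
  apply/polyP => i; rewrite coef_poly big_ord0 mul1r.
  by case: ltnP => // /(nth_default 0) ->.
pose m j := \prod_(k < N) euler_factor (Num.max 0 (u - k%:R)) j.
have [rs1 frs1 <-] : exists2 rs1, full_roots (\poly_(j < size p) (m j * p`_j)) rs1 &
    count (> 0) rs1 = count (> 0) rs := IH p0 frs.
have m0 j : 0 < m j.
  by apply: prodr_gt0 => k _; rewrite euler_factor_gt0// le_max lexx.
set e := Num.max 0 (u - N%:R); have e0 : 0 <= e by rewrite le_max lexx.
have sp : size (\poly_(j < size p) (m j * p`_j)) = size p.
  apply: size_poly_eq; apply: mulf_neq0; first by rewrite gt_eqF.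
  by rewrite -lead_coefE lead_coef_eq0 (full_roots_neq0 frs).
have [|rs2 frs2 <-] := full_roots_euler_factor e0 _ frs1.
  rewrite coef_poly; case: ifP => sp0; first by rewrite mulf_neq0// (gt_eqF (m0 _)).
  by move: p0; rewrite nth_default ?eqxx// leqNgt sp0.
exists rs2 => //; rewrite sp in frs2.
rewrite (_ : \poly_(_ < _) _ =
  \poly_(j < size p) (euler_factor e j * (\poly_(j < size p) (m j * p`_j))`_j))//.
apply/polyP => i; rewrite !coef_poly; case: ifP => // _.
by rewrite big_ord_recr /= mulrA [_ * m i]mulrC.
Qed.

Lemma bernoulli_ge e n : 0 <= e -> 1 + n%:R * e <= (1 + e) ^+ n.
Proof.
move=> e0; elim: n => [|n IH]; first by rewrite mul0r addr0.
rewrite exprS -natr1; have : 0 <= n%:R :> R by [].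
have := ler_wpM2l (_ : 0 <= 1 + e) IH; rewrite addr_ge0// => /(_ isT).
nra.
Qed.

(** Writing [X = 1 + e (j + 1)], the product of the two outer numerators is
[X ^ 2 - e ^ 2], and [X <= e d] because [e >= 1] and [j + 2 <= d]. So the ratio of
the two sides is bounded away from 1 independently of [e]. *)
Lemma euler_factor_gain e j : 1 <= e -> (j.+1 < d)%N ->
  euler_factor e j * euler_factor e j.+2 * (1 + (d%:R ^+ 2)^-1) <=
  euler_factor e j.+1 ^+ 2.
Proof.
move=> e1 jd; have e0 : 0 <= e by lra.
have d0 : 0 < d%:R :> R by rewrite ltr0n (leq_trans _ jd).
have D0 : 0 < 1 + e * d%:R by rewrite ltr_wpDr// mulr_ge0// ltW.
rewrite /euler_factor expr_div_n mulf_div -expr2 mulrAC ler_pM2r ?invr_gt0 ?exprn_gt0//.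
set D := d%:R in d0 D0 *.
have jD : j.+2%:R <= D by rewrite ler_nat.
have D2 : 0 < (D ^+ 2) by rewrite exprn_gt0.
have -> : forall a, a * (1 + (D ^+ 2)^-1) = a + a / D ^+ 2 by move=> a; ring.
rewrite -lerBrDl ler_pdivrMr//.
have n0 : 0 <= j%:R :> R by [].
move: jD; rewrite -!natr1; move: (j%:R) n0 => x x0 xD.
have -> : (1 + e * (x + 1)) ^+ 2 - (1 + e * x) * (1 + e * (x + 1 + 1)) = e ^+ 2 by ring.
rewrite -exprMn; apply: (@le_trans _ _ ((1 + e * (x + 1)) ^+ 2)); first by nra.
rewrite ler_pXn2r ?nnegrE//; nra.
Qed.

Lemma euler_factor_logconcave e j : 0 <= e -> 
  euler_factor e j * euler_factor e j.+2 <= euler_factor e j.+1 ^+ 2.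
Proof.
move=> e0.
have D0 : 0 < 1 + e * d%:R by rewrite ltr_wpDr// mulr_ge0// ltW.
rewrite /euler_factor expr_div_n mulf_div -expr2 ler_pM2r ?invr_gt0 ?exprn_gt0//.
by rewrite -!natr1; nra.
Qed.

(** Each of the [Num.trunc u] factors with parameter at least 1 contributes a gain
[1 + 1 / d ^ 2], and by Bernoulli's inequality the total gain grows at least
linearly in [u]. *)
Lemma flow_logconcave u j : (j.+1 < d)%N -> 1 <= u ->
  flow u j * flow u j.+2 * ((u - 1) / d%:R ^+ 2) <= flow u j.+1 ^+ 2.
Proof.
move=> jd u1; set n := Num.trunc u.
have dd : 0 <= (d%:R ^+ 2)^-1 :> R by rewrite invr_ge0 exprn_ge0.
have un : u - 1 <= n%:R by rewrite lerBlDr natr1 ltW// truncnS_gt.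
have nu : n%:R <= u by rewrite truncn_le; lra.
apply: (@le_trans _ _ (flow u j * flow u j.+2 * (1 + (d%:R ^+ 2)^-1) ^+ n)).
  rewrite ler_pM2l ?mulr_gt0 ?flow_gt0//.
  apply: le_trans (bernoulli_ge n dd).
  by have := ler_wpM2r dd un; lra.
have flowM j1 j2 : flow u j1 * flow u j2 = \prod_(k < n.+1)
    (euler_factor (Num.max 0 (u - k%:R)) j1 * euler_factor (Num.max 0 (u - k%:R)) j2).
  by rewrite big_split.
have f0 k i : 0 <= euler_factor (Num.max 0 (u - k%:R)) i.
  by rewrite ltW// euler_factor_gt0// le_max lexx.
rewrite [flow u _ ^+ 2]expr2 (flowM j) (flowM j.+1) !big_ord_recr /= mulrAC.
have -> : (1 + (d%:R ^+ 2)^-1) ^+ n = \prod_(i < n) (1 + (d%:R ^+ 2)^-1) :> R.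
  by rewrite prodr_const card_ord.
rewrite -big_split /= ler_pM//.
- apply: prodr_ge0 => k _.
  by rewrite mulr_ge0 ?addr_ge0// mulr_ge0.
- by rewrite mulr_ge0.
- apply: ler_prod => k _; apply/andP; split.
    by rewrite mulr_ge0 ?addr_ge0// mulr_ge0.
  rewrite -expr2; apply: euler_factor_gain => //.
  by rewrite le_max; apply/orP; right; rewrite lerBrDl natr1 (le_trans _ nu)// ler_nat.
- by rewrite -expr2; apply: euler_factor_logconcave; rewrite le_max lexx.
Qed.

End Flow.

(** * Coefficient vectors and sign classes *)

Lemma card_uniq_seq (T : choiceType) (s : seq T) : uniq s -> [set` s] #= `I_(size s).
Proof.
move=> us; have /card_eq_fsetP : #|` [fset x in s]%fset| = size s.
  by rewrite card_fseq undup_id.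
rewrite (_ : [set` [fset x in s]%fset] = [set` s])//.
by apply/seteqP; split=> x /=; rewrite !inE.
Qed.

Section RowPoly.
Variables (R : realType) (d : nat).
Implicit Types (a : 'rV[R]_d) (c : nat -> R) (s : d.-tuple bool).

Definition coefs a j : R := (monic_poly_of a)`_j.

Lemma coefs_top a : coefs a d = 1.
Proof.
rewrite /coefs coefD coefXn eqxx coef_sum big1 ?addr0// => i _.
by rewrite coefZ coefXn gtn_eqF ?mulr0.
Qed.

Lemma coefs_ord a (j : 'I_d) : coefs a j = a 0 j.
Proof.
rewrite /coefs coefD coefXn ltn_eqF// add0r coef_sum (bigD1 j)//= big1.
  by rewrite coefZ coefXn eqxx mulr1 addr0.
by move=> i ij; rewrite coefZ coefXn eq_sym (inj_eq val_inj) (negbTE ij) mulr0.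
Qed.

Lemma monic_poly_of_row c : c d = 1 ->
  monic_poly_of (\row_(j < d) c j) = \poly_(j < d.+1) c j.
Proof.
move=> cd; rewrite poly_def big_ord_recr /= cd scale1r addrC; congr (_ + _).
by apply: eq_bigr => j _; rewrite mxE.
Qed.

Lemma monic_poly_ofE a : monic_poly_of a = \poly_(j < d.+1) coefs a j.
Proof.
rewrite -monic_poly_of_row ?coefs_top//; congr monic_poly_of.
by apply/rowP => j; rewrite mxE coefs_ord.
Qed.

Lemma size_monic_poly_of a : size (monic_poly_of a) = d.+1.
Proof. by rewrite monic_poly_ofE size_poly_eq// coefs_top oner_eq0. Qed.

Lemma monic_poly_of_monic a : lead_coef (monic_poly_of a) = 1.
Proof. by rewrite lead_coefE size_monic_poly_of -[RHS](coefs_top a). Qed.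

Lemma full_rootsP a : [set x | root (monic_poly_of a) x] #= `I_d <->
  exists rs, full_roots (monic_poly_of a) rs.
Proof.
split=> [cd|[rs frs]]; last first.
  have /and3P[urs + _] := frs; rewrite size_monic_poly_of => /eqP[dE].
  have := card_uniq_seq urs; rewrite -dE.
  rewrite (_ : [set` rs] = [set x | root (monic_poly_of a) x])//.
  by apply/seteqP; split=> x /=; rewrite (mem_full_roots _ frs).
have fin : finite_set [set x | root (monic_poly_of a) x] by exists d.
exists (fset_set [set x | root (monic_poly_of a) x]).
apply/and3P; split; first exact: fset_uniq.
- by rewrite size_monic_poly_of (card_fset_set cd).
- by apply/allP => x; rewrite in_fset_set// => /set_mem.
Qed.

Definition sign_class s : set 'rV[R]_d :=
  Pi_star R d `&` [set a | forall j, Num.sg (a 0 j) = (-1) ^+ tnth s j].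

Lemma signs_neq0 a s : (forall j, Num.sg (a 0 j) = (-1) ^+ tnth s j) ->
  forall j, a 0 j != 0.
Proof. by move=> h j; rewrite -sgr_eq0 h signr_eq0. Qed.

Lemma coefs_neq0 a : (forall j, a 0 j != 0) -> forall j, (j <= d)%N -> coefs a j != 0.
Proof.
move=> a0 j; rewrite leq_eqVlt => /predU1P[->|jd]; first by rewrite coefs_top oner_eq0.
by rewrite (coefs_ord _ (Ordinal jd)).
Qed.

Lemma sg_coefs a s : (forall j, Num.sg (a 0 j) = (-1) ^+ tnth s j) ->
  forall j, (j <= d)%N -> Num.sg (coefs a j) = (-1) ^+ nth false s j.
Proof.
move=> h j; rewrite leq_eqVlt => /predU1P[->|jd].
  by rewrite coefs_top sgr1 nth_default ?size_tuple.
by rewrite (coefs_ord _ (Ordinal jd)) h (tnth_nth false).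
Qed.

(** The default value [false] of [nth] at index [d] is the sign of the leading
coefficient. *)
Lemma sign_changesE s : sign_changes s =
  count (fun j => nth false s j != nth false s j.+1) (iota 0 d).
Proof.
rewrite /sign_changes; move: (tval s) (size_tuple s) => {}s <-.
elim: s => [//|b t IH].
have rc (f : bool -> bool -> bool) x u y :
    pairmap f x (rcons u y) = rcons (pairmap f x u) (f (last x u) y).
  by elim: u x => //= z u ih x; rewrite ih.
rewrite rev_cons rc -cats1 count_cat IH /= addn0 addnC -[1%N]/(1 + 0)%N iotaDl count_map.
congr (_ + _)%N.
rewrite nth0 eq_sym; congr ((_ != _) : nat).
by case: t {IH} => //= c t; rewrite rev_cons last_rcons.
Qed.

End RowPoly.

(** * The retraction of a sign class *)

Section Retraction.
Variables (R : realType) (d : nat).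
Implicit Types (a : 'rV[R]_d) (c : nat -> R) (s : d.-tuple bool).

Definition lacunary c := forall j, (j.+1 < d)%N -> 9 * `|c j * c j.+2| <= c j.+1 ^+ 2.

Definition has_signs s c := forall j, (j <= d)%N -> Num.sg (c j) = (-1) ^+ nth false s j.

Lemma has_signs_neq0 s c : has_signs s c -> forall j, (j <= d)%N -> c j != 0.
Proof. by move=> h j jd; rewrite -sgr_eq0 h// signr_eq0. Qed.

Lemma has_signsE s c j : has_signs s c -> (j <= d)%N ->
  c j = (-1) ^+ nth false s j * `|c j|.
Proof. by move=> h jd; rewrite -h// -numEsg. Qed.

Lemma sign_class_row s c : has_signs s c -> c d = 1 ->
  (exists rs, full_roots (\poly_(j < d.+1) c j) rs) -> sign_class s (\row_(j < d) c j).
Proof.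
move=> hc cd hr; have h (j : 'I_d) : Num.sg ((\row_(j < d) c j) 0 j) = (-1) ^+ tnth s j.
  by rewrite mxE hc 1?ltnW// (tnth_nth false).
split => //; split; last exact: signs_neq0 h.
by apply/full_rootsP; rewrite monic_poly_of_row.
Qed.

Lemma has_signs_coefs s a : sign_class s a -> has_signs s (coefs a).
Proof. by case=> _ h j; apply: sg_coefs. Qed.

Lemma lacunary_sign_changes s c rs : has_signs s c -> lacunary c ->
  full_roots (\poly_(j < d.+1) c j) rs -> count (> 0) rs = sign_changes s.
Proof.
move=> hc lc frs.
have [rs' frs' crs'] := lacunary_full_roots (has_signs_neq0 hc) lc.
rewrite (permP (full_roots_perm frs frs')) crs' sign_changesE.
apply: eq_in_count => j; rewrite mem_iota /= add0n => jd.
rewrite -sgr_lt0 sgrM hc ?(ltnW jd)// hc//.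
by case: (nth false s j); case: (nth false s j.+1);
  rewrite /= ?expr0 ?expr1 ?mulr1 ?mul1r ?mulrNN ?mulr1 ?ltrN10 ?ltr10.
Qed.

(** By [flow_logconcave], at this time the gain has outweighed each of the ratios
[9 |a_j a_(j+2)| / a_(j+1) ^ 2]. A sum replaces their maximum to have a rational
expression. *)
Definition escape_time a : R := 1 + 9 * d%:R ^+ 2 *
  \sum_(j < d.-1) `|coefs a j * coefs a j.+2| / coefs a j.+1 ^+ 2.

Lemma escape_time_ge1 a : 1 <= escape_time a.
Proof.
rewrite lerDl !mulr_ge0 ?exprn_ge0//; apply: sumr_ge0 => j _.
by rewrite divr_ge0 ?sqr_ge0.
Qed.

Lemma lacunary_flow a : (forall j, (j <= d)%N -> coefs a j != 0) ->
  lacunary (fun j => flow d (escape_time a) j * coefs a j).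
Proof.
move=> a0 j jd; set u := escape_time a.
have d0 : 0 < d%:R ^+ 2 :> R by rewrite exprn_gt0// ltr0n; case: (d) jd.
have aj : 0 < coefs a j.+1 ^+ 2 by rewrite exprn_even_gt0//= a0// ltnW.
have jd' : (j < d.-1)%N by rewrite ltn_predRL.
have hu : 9 * (`|coefs a j * coefs a j.+2| / coefs a j.+1 ^+ 2) <= (u - 1) / d%:R ^+ 2.
  rewrite /u /escape_time addrAC subrr add0r mulrAC mulfK ?gt_eqF//.
  rewrite ler_pM2l// (bigD1 (Ordinal jd'))//= lerDl sumr_ge0// => i _.
  by rewrite divr_ge0 ?sqr_ge0.
have := flow_logconcave jd (escape_time_ge1 a); rewrite -/u.
have ff : 0 < flow d u j * flow d u j.+2 by rewrite mulr_gt0 ?flow_gt0.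
move=> /(ler_wpM2r (ltW aj)); rewrite exprMn; apply: le_trans.
rewrite mulrACA normrM (gtr0_norm ff) mulrCA -[leRHS]mulrA ler_pM2l//.
by move: hu; rewrite mulrA ler_pdivrMr.
Qed.

(** The equality case of the rule of Descartes: the flow changes neither the signs
of the coefficients nor the number of positive roots, and for lacunary
coefficients the count is known. *)
Lemma full_roots_count_pos s a rs : sign_class s a -> full_roots (monic_poly_of a) rs ->
  count (> 0) rs = sign_changes s.
Proof.
move=> sa frs; have ha := has_signs_coefs sa; have a0 := has_signs_neq0 ha.
have [|rs' frs' <-] := full_roots_flow d (escape_time a) _ frs; first exact: a0.
rewrite size_monic_poly_of in frs'.
apply: lacunary_sign_changes frs'; last exact: lacunary_flow.
by move=> j jd; rewrite sgrM gtr0_sg ?flow_gt0// mul1r ha.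
Qed.

(** The [d] roots are simple and nonzero, so the count of negative roots follows
from that of positive roots. *)
Lemma sign_class_realizes s a : sign_class s a -> realizes s a.
Proof.
move=> sa; have [[/full_rootsP[rs frs] a0] sga] := sa.
have /and3P[urs /eqP srs _] := frs.
have cpos := full_roots_count_pos sa frs.
have p0 : 0 \notin rs.
  by rewrite (mem_full_roots _ frs) rootE horner_coef0 (coefs_neq0 a0).
have mupE x : mup x (monic_poly_of a) = (x \in rs) :> nat.
  rewrite (full_rootsE frs) monic_poly_of_monic scale1r mu_prod_XsubC.
  by rewrite count_uniq_mem.
have simpleE (P : pred R) : [set x | P x /\ mup x (monic_poly_of a) = 1%N] =
    [set` [seq x <- rs | P x]].
  apply/seteqP; split=> x /=; rewrite mem_filter mupE.
    by case=> ->; case: (x \in rs).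
  by move=> /andP[-> ->].
have cneg : count (< 0) rs = sign_preservations s.
  rewrite sign_preservationsE -cpos.
  have [dE] : d.+1 = (size rs).+1 by rewrite -srs size_monic_poly_of.
  rewrite [X in (X - _)%N]dE -(count_predC (> 0)) addKn.
  apply: eq_in_count => x xrs /=; rewrite -leNgt lt_neqAle.
  by case: eqP xrs p0 => // -> ->.
split => //; rewrite -?cpos -?cneg -size_filter.
- rewrite [positive_simple_roots _](simpleE (> 0)); exact/card_uniq_seq/filter_uniq.
- rewrite [negative_simple_roots _](simpleE (< 0)); exact/card_uniq_seq/filter_uniq.
Qed.

(** The contraction flows for [t <= 1/2] and interpolates for [t >= 1/2]; the two
clamped phases give one formula for both, continuous without gluing. *)
Definition flow_phase (t : R) : R := Num.min 1 (2 * t).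
Definition blend_phase (t : R) : R := Num.max 0 (2 * t - 1).

(** A sequence vanishing at [d] with constant second difference [- 2 ln 3], which
is exactly the lacunary bound. *)
Definition base_log j : R := j%:R * (d%:R - j%:R) * ln 3.

Definition contraction_log a t j : R :=
  (1 - blend_phase t) * ln (flow d (flow_phase t * escape_time a) j * `|coefs a j|) +
  blend_phase t * base_log j.

Definition contraction s a t : 'rV[R]_d :=
  \row_(j < d) ((-1) ^+ tnth s j * expR (contraction_log a t j)).

Definition base_point s : 'rV[R]_d := \row_(j < d) ((-1) ^+ tnth s j * expR (base_log j)).

Lemma row_signs s (u : nat -> R) :
  \row_(j < d) ((-1) ^+ tnth s j * expR (u j)) =
  \row_(j < d) ((-1) ^+ nth false s j * expR (u j)).
Proof. by apply/rowP => j; rewrite !mxE (tnth_nth false). Qed.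

Lemma has_signs_exp s (u : nat -> R) :
  has_signs s (fun j => (-1) ^+ nth false s j * expR (u j)).
Proof.
by move=> j jd; rewrite sgrM (gtr0_sg (expR_gt0 _)) mulr1; case: nth; rewrite ?sgrN sgr1.
Qed.

(** In logarithmic coordinates lacunarity is a family of affine inequalities. *)
Lemma lacunary_exp s (u : nat -> R) :
  lacunary (fun j => (-1) ^+ nth false s j * expR (u j)) <->
  forall j, (j.+1 < d)%N -> 2 * ln 3 + u j + u j.+2 <= 2 * u j.+1.
Proof.
have e9 : 9 = expR (2 * ln 3) :> R.
  by rewrite mulrC expRM_natr lnK ?posrE//; ring.
have E j : (9 * `|(-1) ^+ nth false s j * expR (u j) *
     ((-1) ^+ nth false s j.+2 * expR (u j.+2))|
   <= ((-1) ^+ nth false s j.+1 * expR (u j.+1)) ^+ 2) =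
  (2 * ln 3 + u j + u j.+2 <= 2 * u j.+1).
  rewrite !normrM !normr_sign !mul1r !gtr0_norm ?expR_gt0// exprMn sqrr_sign mul1r.
  by rewrite e9 -!expRD -expRM_natr ler_expR addrA [u j.+1 * _]mulrC.
by split=> h j jd; have := h j jd; rewrite E.
Qed.

Lemma sign_class_exp s (u : nat -> R) : u d = 0 ->
  (forall j, (j.+1 < d)%N -> 2 * ln 3 + u j + u j.+2 <= 2 * u j.+1) ->
  sign_class s (\row_(j < d) ((-1) ^+ tnth s j * expR (u j))).
Proof.
move=> ud /(lacunary_exp s) lu; rewrite row_signs.
have hs := has_signs_exp s u.
apply: (sign_class_row (c := fun j => (-1) ^+ nth false s j * expR (u j))) => //.
  by rewrite ud expR0 nth_default ?size_tuple ?mulr1.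
by have [rs frs _] := lacunary_full_roots (has_signs_neq0 hs) lu; exists rs.
Qed.

Lemma base_log_lacunary j :
  2 * ln 3 + base_log j + base_log j.+2 <= 2 * base_log j.+1.
Proof. by rewrite /base_log -!natr1; lra. Qed.

Lemma base_log_top : base_log d = 0.
Proof. by rewrite /base_log subrr mulr0 mul0r. Qed.

Lemma sign_class_base s : sign_class s (base_point s).
Proof.
exact: sign_class_exp base_log_top (fun j _ => base_log_lacunary j).
Qed.

Lemma contraction0 s a : sign_class s a -> contraction s a 0 = a.
Proof.
move=> sa; have ha := has_signs_coefs sa; apply/rowP => j; rewrite mxE.
rewrite /contraction_log /flow_phase /blend_phase mulr0 sub0r.
rewrite (min_idPr _)// (max_idPl _) ?oppr_le0//.
rewrite subr0 mul0r mul1r mul0r addr0 flow0 mul1r lnK; last first.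
  by rewrite posrE normr_gt0 (has_signs_neq0 ha)// ltnW.
by rewrite (tnth_nth false) -(has_signsE ha) 1?ltnW// coefs_ord.
Qed.

Lemma contraction1 s a : contraction s a 1 = base_point s.
Proof.
apply/rowP => j; rewrite !mxE /contraction_log /blend_phase (max_idPr _); last by lra.
by rewrite (_ : 2 * 1 - 1 = 1 :> R) ?subrr ?mul0r ?mul1r ?add0r//; ring.
Qed.

(** In the first phase the point is the image of [a] under the flow. In the second
one it lies on a segment, in logarithmic coordinates, between two lacunary
points, hence is lacunary. *)
Lemma sign_class_contraction s a t : sign_class s a -> 0 <= t <= 1 ->
  sign_class s (contraction s a t).
Proof.
move=> sa /andP[t0 t1]; have ha := has_signs_coefs sa; have a0 := has_signs_neq0 ha.
have Fpos u j : (j <= d)%N -> 0 < flow d u j * `|coefs a j|.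
  by move=> jd; rewrite mulr_gt0 ?flow_gt0 ?normr_gt0 ?a0.
have [t2|t2] := leP (2 * t) 1.
  have -> : contraction s a t =
      \row_(j < d) (flow d (flow_phase t * escape_time a) j * coefs a j).
    apply/rowP => j; rewrite !mxE /contraction_log /blend_phase (max_idPl _) ?subr_le0//.
    rewrite subr0 mul1r mul0r addr0 lnK ?posrE ?Fpos 1?ltnW//.
    by rewrite mulrCA (tnth_nth false) -(has_signsE ha) 1?ltnW.
  apply: (sign_class_row (c := fun j =>
    flow d (flow_phase t * escape_time a) j * coefs a j)).
  - by move=> j jd; rewrite sgrM gtr0_sg ?flow_gt0// mul1r ha.
  - by rewrite flow_top coefs_top mulr1.
  - have [[/full_rootsP[rs frs] _] _] := sa.
    have [|rs' frs' _] := full_roots_flow d (flow_phase t * escape_time a) _ frs.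
      exact: a0.
    by exists rs'; rewrite size_monic_poly_of in frs'.
apply: sign_class_exp => [|j jd].
  by rewrite /contraction_log flow_top coefs_top normr1 mulr1 ln1 base_log_top !mulr0 addr0.
rewrite /contraction_log /flow_phase (min_idPl _) ?(ltW t2)// mul1r.
have b0 : 0 <= blend_phase t by rewrite le_max lexx.
have b1 : blend_phase t <= 1 by rewrite ge_max ler01 /=; lra.
have := base_log_lacunary j.
set v := fun j => ln (flow d (escape_time a) j * `|coefs a j|).
have /(lacunary_exp s v)/(_ j jd) : lacunary (fun j => (-1) ^+ nth false s j * expR (v j)).
  have vE k : (k <= d)%N ->
      (-1) ^+ nth false s k * expR (v k) = flow d (escape_time a) k * coefs a k.
    by move=> kd; rewrite lnK ?posrE ?Fpos// mulrCA -(has_signsE ha).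
  move=> i id; rewrite !vE//; first exact: lacunary_flow.
  - exact: ltnW.
  - exact/ltnW/ltnW.
rewrite -/(v j) -/(v j.+1) -/(v j.+2).
move: (blend_phase t) b0 b1 (v j) (v j.+1) (v j.+2).
move: (base_log j) (base_log j.+1) (base_log j.+2).
move=> w0 w1 w2 b b0 b1 v0 v1 v2 hv hw.
have := ler_wpM2l b0 hw; have := ler_wpM2l (_ : 0 <= 1 - b) hv.
rewrite subr_ge0 b1 => /(_ isT).
lra.
Qed.

End Retraction.

(** * Openness, continuity and connectedness *)

(** Every point is joined to the centre of the contraction by the trajectory of
the homotopy. *)
Lemma contractible_connected (R : realType) (T : topologicalType) (A : set T) :
  contractible R A -> connected A.
Proof.
move=> [x0 Ax0 [H [Hc HA H0 H1]]].
have in01 (t : R) : `[0, 1]%classic t -> t \in `[0, 1] by [].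
have -> : A = \bigcup_(a in A) [set H (a, t) | t in `[0, 1]%classic].
  apply/seteqP; split=> [a Aa|_ [a Aa [t t01 <-]]]; last exact: HA (in01 _ t01).
  by exists a => //; exists 0; rewrite ?H0//= in_itv /= lexx ler01.
apply: bigcup_connected.
  by exists x0 => a Aa; exists 1; rewrite ?H1//= in_itv /= lexx ler01.
move=> a Aa; apply: connected_continuous_connected; first exact: segment_connected.
apply/subspace_continuousP => t t01.
move/subspace_continuousP : Hc => /(_ (a, t) (conj Aa t01)) Hat.
apply: (cvg_comp (fun t' => (a, t')) _ _ Hat) => W.
rewrite /within /= => nW.
have pc : (fun t' : R => (a, t')) @ t --> (a, t).
  exact: (cvg_pair (f := fun=> a) (g := id)
    (cvg_cst a (F := nbhs t)) (@cvg_id _ (nbhs t))).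
have := pc _ nW; rewrite nbhs_simpl /=. apply: filterS => t' /= h t'01; exact: h.
Qed.

Section Topology.
Variables (R : realType) (d : nat).
Implicit Types (a : 'rV[R]_d) (s : d.-tuple bool).

Lemma cvg_row (T : Type) (F : set_system T) {FF : Filter F} (g : T -> 'rV[R]_d) a :
  (forall j, g x 0 j @[x --> F] --> a 0 j) -> g @ F --> a.
Proof.
move=> gj A [P aP sPA]; have : \forall x \near F, forall j, P 0 j (g x 0 j).
  by apply: filter_forall => j; apply: gj; exact: aP.
by apply: filterS => x gP; apply: sPA => i j; rewrite ord1.
Qed.

Lemma cvg_sum (T I : Type) (F : set_system T) {FF : Filter F} (r : seq I)
    (f : I -> T -> R) (l : I -> R) :
  (forall i, f i x @[x --> F] --> l i) ->
  \sum_(i <- r) f i x @[x --> F] --> \sum_(i <- r) l i.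
Proof. by move=> fl; apply: cvg_big => //; exact: add_continuous. Qed.

Lemma cvg_prod (T I : Type) (F : set_system T) {FF : Filter F} (r : seq I)
    (f : I -> T -> R) (l : I -> R) :
  (forall i, f i x @[x --> F] --> l i) ->
  \prod_(i <- r) f i x @[x --> F] --> \prod_(i <- r) l i.
Proof. by move=> fl; apply: cvg_big => //; exact: mul_continuous. Qed.

Lemma continuous_coefs j : continuous (fun a => coefs a j).
Proof.
case: (ltnP j d) => jd.
  rewrite (_ : (fun _ => _) = (fun b : 'rV[R]_d => b 0 (Ordinal jd))); last first.
    by apply/funext => b; rewrite -coefs_ord.
  exact: coord_continuous.
rewrite (_ : (fun _ => _) = (fun b : 'rV[R]_d => (j == d)%:R)); last first.
  apply/funext => b; rewrite /coefs monic_poly_ofE coef_poly ltnS leq_eqVlt.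
  by rewrite [(j < d)%N]ltnNge jd orbF; case: eqP => // ->; rewrite coefs_top.
exact: cst_continuous.
Qed.

Lemma continuous_monic_horner (x : R) : continuous (fun a => (monic_poly_of a).[x]).
Proof.
rewrite (_ : (fun _ => _) = (fun b => \sum_(j < d.+1) coefs b j * x ^+ j)); last first.
  by apply/funext => b; rewrite monic_poly_ofE horner_poly.
move=> a; apply: (@cvg_sum _ _ (nbhs a)) => j.
by apply: cvgM; [exact: continuous_coefs|exact: cvg_cst].
Qed.

Lemma near_pos (T : topologicalType) (f : T -> R) x :
  {for x, continuous f} -> 0 < f x -> \forall y \near x, 0 < f y.
Proof. by move=> fx f0; apply: (cvgr_gt _ fx). Qed.

Lemma separation_radius (rs : seq R) :
  exists2 e : R, 0 < e & {in rs &, forall r r', r != r' -> 2 * e < `|r - r'|}.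
Proof.
have : \forall e \near (0 : R)^'+, forall i j : 'I_(size rs),
    rs`_i != rs`_j -> 2 * e < `|rs`_i - rs`_j|.
  apply: filter_forall => i; apply: filter_forall => j.
  have [->|ij] := eqVneq (rs`_i) rs`_j; first by apply: nearW.
  near=> e => _; rewrite mulrC -ltr_pdivlMr//; near: e.
  by apply: nbhs_right_lt; rewrite divr_gt0// normr_gt0 subr_eq0.
move=> h; have [e [he e0]] := filter_ex (filterI h (nbhs_right_gt 0)).
exists e => // r r' /(nthP 0)[i il <-] /(nthP 0)[j jl <-].
exact: (he (Ordinal il) (Ordinal jl)).
Unshelve. all: by end_near. Qed.

(** The factor of [r] contributes [- e ^ 2], and that of any other root [z]
contributes [(r - z) ^ 2 - e ^ 2 > 0]. *)
Lemma simple_root_sign_change (p : {poly R}) rs e r : full_roots p rs -> 0 < e ->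
  {in rs &, forall r r', r != r' -> 2 * e < `|r - r'|} -> r \in rs ->
  p.[r - e] * p.[r + e] < 0.
Proof.
move=> frs e0 sep rin; have urs : uniq rs by case/and3P: frs.
rewrite (full_rootsE frs) (big_rem r)//= !hornerZ !hornerM !horner_prod !hornerXsubC.
set c := lead_coef p; have c0 : 0 < c ^+ 2.
  by rewrite exprn_even_gt0//= lead_coef_eq0 (full_roots_neq0 frs).
set A := \prod_(i <- _) _; set B := \prod_(i <- _) _.
have AB : 0 < A * B.
  rewrite /A /B -big_split /= big_seq; apply: prodr_gt0 => z.
  rewrite mem_rem_uniq// inE => /andP[zr zin]; rewrite !hornerXsubC.
  rewrite (_ : _ * _ = (r - z) ^+ 2 - e ^+ 2); last by ring.
  have := sep _ _ rin zin; rewrite eq_sym => /(_ zr) h.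
  rewrite subr_gt0 -[ltRHS]real_normK ?num_real// ltr_pXn2r ?nnegrE ?(ltW e0)//.
  by apply: le_lt_trans h; lra.
rewrite (_ : _ * _ = - (c ^+ 2 * e ^+ 2 * (A * B))); last by ring.
by rewrite oppr_lt0 mulr_gt0// mulr_gt0// exprn_gt0.
Qed.

(** A sign change between [r - e] and [r + e] is stable under small perturbations
of the coefficients, and produces a root close to each [r]. *)
Lemma open_sign_class s : open (sign_class (R := R) s).
Proof.
rewrite openE => a sa; have ha := has_signs_coefs sa.
have [[/full_rootsP[rs frs] _] sga] := sa.
have [e e0 sep] := separation_radius rs.
have nroots : \forall b \near a, forall i : 'I_(size rs),
    0 < - ((monic_poly_of b).[rs`_i - e] * (monic_poly_of b).[rs`_i + e]).
  apply: (@filter_forall _ _ _ (nbhs a)) => i; apply: (@near_pos _ (fun b =>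
    - ((monic_poly_of b).[rs`_i - e] * (monic_poly_of b).[rs`_i + e]))).
    by apply: continuousN; apply: continuousM; exact: continuous_monic_horner.
  by rewrite oppr_gt0 (simple_root_sign_change frs e0 sep)// mem_nth.
have nsigns : \forall b \near a, forall j : 'I_d,
    0 < (-1) ^+ tnth s j * (b : 'rV[R]_d) 0 j.
  apply: (@filter_forall _ _ _ (nbhs a)) => j.
  apply: (@near_pos _ (fun b : 'rV[R]_d => (-1) ^+ tnth s j * b 0 j)).
    by apply: continuousM; [exact: cst_continuous|exact: coord_continuous].
  by rewrite -sga -normrEsg normr_gt0; exact: (signs_neq0 sga).
apply: filterS2 nroots nsigns => b broots bsigns.
have bs j : Num.sg (b 0 j) = (-1) ^+ tnth s j.
  have := bsigns j; case: (tnth s j); rewrite /= ?expr0 ?expr1 ?mul1r ?mulN1r ?oppr_gt0.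
    exact: ltr0_sg.
  exact: gtr0_sg.
split => //; split; last exact: signs_neq0 bs.
apply/full_rootsP.
suff /choice[z zP] : forall r, exists z,
    r \in rs -> `|z - r| < e /\ root (monic_poly_of b) z.
  (* The new roots are distinct as the balls of radius [e] around [rs] are disjoint. *)
  exists (map z rs); apply/and3P; split.
  - rewrite map_inj_in_uniq; first by case/and3P: frs.
    move=> r r' rin r'in zz; apply/eqP/negP => /negP /(sep _ _ rin r'in).
    have [h1 _] := zP _ rin; have [h2 _] := zP _ r'in.
    apply/negP; rewrite -leNgt.
    rewrite (_ : r - r' = (z r' - r') - (z r - r)); last by rewrite zz; ring.
    by apply: le_trans (ler_normB _ _) _; lra.
  - have /and3P[_ + _] := frs; rewrite !size_monic_poly_of => /eqP dE.
    by rewrite size_map -dE.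
  - by apply/allP => _ /mapP[r rin ->]; have [] := zP _ rin.
move=> r; case: (boolP (r \in rs)) => [/(nthP 0)[i il <-]|_]; last by exists 0.
have := broots (Ordinal il); rewrite oppr_gt0 => pe.
have re : rs`_i - e < rs`_i + e by lra.
have [z /andP[z1 z2] rz] := poly_ivt_strict re pe.
exists z => _; split => //; rewrite ltr_norml; apply/andP; split; lra.
Qed.

Lemma continuous_euler_factor (e : R) j : 0 <= e ->
  {for e, continuous (fun e : R => euler_factor d e j)}.
Proof.
move=> e0; apply: cvgM.
  by apply: cvgD; [exact: cvg_cst|apply: cvgM; [exact: cvg_id|exact: cvg_cst]].
apply: cvgV; first by rewrite gt_eqF// ltr_wpDr// mulr_ge0.
by apply: cvgD; [exact: cvg_cst|apply: cvgM; [exact: cvg_id|exact: cvg_cst]].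
Qed.

(** Near [u] the number of factors can be fixed, since the extra ones are 1. *)
Lemma continuous_flow j : continuous (fun u : R => flow d u j).
Proof.
move=> u; pose N := (Num.trunc u).+1.
have uN : u < N%:R by exact: truncnS_gt.
rewrite /continuous_at (flow_prod d j (ltW uN)).
have nE : {near u, (fun v => \prod_(k < N) euler_factor d (Num.max 0 (v - k%:R)) j) =1
    (fun v => flow d v j)}.
  near=> v; rewrite (@flow_prod _ _ v N)//.
  by apply/ltW; near: v; exact: lt_nbhsl.
apply: cvg_trans (near_eq_cvg nE) _; apply: (@cvg_prod _ _ (nbhs u)) => k; 
apply: (@continuous_cvg _ _ _ (nbhs u) _ (fun v : R => Num.max 0 (v - k%:R))
  (fun e : R => euler_factor d e j)).
  by apply: continuous_euler_factor; rewrite le_max lexx.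
apply: (@continuous_max _ _ (fun=> 0) (fun v : R => v - k%:R)).
  exact: cst_continuous.
by apply: continuousB; [move=> ?; exact: cvg_id|exact: cst_continuous].
Unshelve. all: by end_near. Qed.

Lemma continuous_escape_time a : (forall j, (j <= d)%N -> coefs a j != 0) ->
  {for a, continuous (@escape_time R d)}.
Proof.
move=> a0; apply: continuousD; first exact: cst_continuous.
apply: continuousM; first exact: cst_continuous.
apply: (@cvg_sum _ _ (nbhs a)) => j; have cc k := @continuous_coefs k a.
apply: (cvgM (cvg_norm (cvgM (cc j) (cc j.+2))) (cvgV _ (cvgM (cc j.+1) (cc j.+1)))).
have := ltn_ord j; rewrite ltn_predRL => jd.
by rewrite mulf_neq0// a0// ltnW.
Qed.

Lemma continuous_flow_phase : continuous (@flow_phase R).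
Proof.
move=> t; apply: (@continuous_min _ _ (fun=> 1) (fun t : R => 2 * t)).
  exact: cst_continuous.
by apply: continuousM; [exact: cst_continuous|move=> ?; exact: cvg_id].
Qed.

Lemma continuous_blend_phase : continuous (@blend_phase R).
Proof.
move=> t; apply: (@continuous_max _ _ (fun=> 0) (fun t : R => 2 * t - 1)).
  exact: cst_continuous.
apply: continuousB; last exact: cst_continuous.
by apply: continuousM; [exact: cst_continuous|move=> ?; exact: cvg_id].
Qed.

Lemma continuous_contraction s a t : sign_class s a ->
  {for (a, t), continuous (fun z : 'rV[R]_d * R => contraction s z.1 z.2)}.
Proof.
move=> sa; have a0 := has_signs_neq0 (has_signs_coefs sa).
apply: cvg_row => j; under eq_cvg do rewrite mxE; rewrite mxE.
have cfst : (fun z : 'rV[R]_d * R => z.1) @ (a, t) --> a by exact: cvg_fst.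
have csnd : (fun z : 'rV[R]_d * R => z.2) @ (a, t) --> t by exact: cvg_snd.
have cflow : (fun z : 'rV[R]_d * R => flow_phase z.2) @ (a, t) --> flow_phase t.
  exact: (@continuous_cvg _ _ _ (nbhs (a, t)) _ snd
    (@flow_phase R) t (@continuous_flow_phase t) csnd).
have cblend : (fun z : 'rV[R]_d * R => blend_phase z.2) @ (a, t) --> blend_phase t.
  exact: (@continuous_cvg _ _ _ (nbhs (a, t)) _ snd
    (@blend_phase R) t (@continuous_blend_phase t) csnd).
apply: cvgM; first exact: cvg_cst.
apply: continuous_cvg; first exact: continuous_expR.
apply: cvgD; last by apply: cvgM => //; exact: cvg_cst.
apply: cvgM; first by apply: cvgB => //; exact: cvg_cst.
apply: continuous_cvg.
  by apply: continuous_ln; rewrite mulr_gt0 ?flow_gt0// normr_gt0 a0// ltnW.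
apply: cvgM.
  apply: (@continuous_cvg _ _ _ (nbhs (a, t)) _ (fun z : 'rV[R]_d * R =>
    flow_phase z.2 * escape_time z.1) (fun u => flow d u j)).
    exact: continuous_flow.
  apply: cvgM => //.
  apply: (@continuous_cvg _ _ _ (nbhs (a, t)) _ fst (@escape_time R d)) => //.
  exact: continuous_escape_time.
apply: cvg_norm.
apply: (@continuous_cvg _ _ _ (nbhs (a, t)) _ fst (fun a => coefs a j)) => //.
exact: continuous_coefs.
Qed.

Lemma contractible_sign_class s : contractible R (sign_class (R := R) s).
Proof.
exists (base_point R s); first exact: sign_class_base.
exists (fun z => contraction s z.1 z.2); split => /=.
- apply: continuous_in_subspaceT => -[a t] /set_mem [/= sa _].
  exact: continuous_contraction.
- by move=> a t sa; rewrite in_itv /=; exact: sign_class_contraction.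
- by move=> a sa; exact: contraction0.
- by move=> a sa; exact: contraction1.
Qed.

(** Each coefficient maps [K] onto an interval that avoids 0. *)
Lemma connected_signs (K : set 'rV[R]_d) a s : connected K -> K `<=` Pi_star R d ->
  K a -> sign_class s a -> K `<=` sign_class s.
Proof.
move=> cK KP Ka [_ sa] b Kb; split; first exact: KP.
move=> j; rewrite -sa.
have : is_interval [set x 0 j | x in K].
  apply/connected_intervalP; apply: connected_continuous_connected => //.
  by apply: continuous_subspaceT; exact: coord_continuous.
move=> itvK.
have n0 c : K c -> c 0 j != 0 by move=> /KP[].
have nK : ~ [set x 0 j | x in K] 0.
  by move=> [c Kc c0]; have := n0 _ Kc; rewrite c0 eqxx.
have [aj|aj|aj] := ltgtP (a 0 j) 0; last by have := n0 _ Ka; rewrite aj eqxx.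
- have [bj|bj|bj] := ltgtP (b 0 j) 0; last by have := n0 _ Kb; rewrite bj eqxx.
    by rewrite !ltr0_sg.
  exfalso; apply: nK; apply: (itvK (a 0 j) (b 0 j)); [by exists a|by exists b|].
  by rewrite !ltW.
- have [bj|bj|bj] := ltgtP (b 0 j) 0; last by have := n0 _ Kb; rewrite bj eqxx.
    exfalso; apply: nK; apply: (itvK (b 0 j) (a 0 j)); [by exists b|by exists a|].
    by rewrite !ltW.
  by rewrite !gtr0_sg.
Qed.

Lemma sign_class_component s a : sign_class s a ->
  connected_component (Pi_star R d) a = sign_class s.
Proof.
move=> sa; apply/seteqP; split.
  apply: (@connected_signs _ a) => //.
  - exact: component_connected.
  - exact: connected_component_sub.
  - by apply: connected_component_refl; case: sa.
apply: connected_component_max => //; first by move=> b [].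
exact/contractible_connected/contractible_sign_class.
Qed.

End Topology.

Theorem theorem2 (R : realType) (d : nat) (hd : (1 <= d)%N)
    (s : d.-tuple bool) :
  exists C : set 'rV[R]_d,
    [/\ unique (fun K : set 'rV[R]_d =>
          (connected_component (Pi_star R d) @` Pi_star R d) K /\
          (forall a, K a -> realizes s a)) C,
        open C &
        contractible R C].
Proof.
exists (sign_class s); split; [|exact: open_sign_class|exact: contractible_sign_class].
have sb := sign_class_base R s.
split; first split.
- by exists (base_point R s); [case: sb|exact: sign_class_component].
- by move=> a; exact: sign_class_realizes.
move=> _ [[a Pa <-] real].
have [|_ _ sga] := real a; first exact: connected_component_refl.
exact/esym/sign_class_component.
Qed.
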